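(* Let $G$ be a connected graph and $T$ its block tree. (i) If every maximal biconnected component (block) of $G$ belongs to $\textsc{And}(1)$ and $T$ can be rooted so that every cut-vertex is safe (with respect to $\textsc{And}(1)$) in its descendant blocks, then $G\in\textsc{And}(1)$. (ii) The same statement holds with $\textsc{And}(1)$ replaced by $c$-$\textsc{And}(1)$ throughout.
   Context: All graphs are finite, simple and connected. The block tree of $G$ has as vertices the blocks (maximal biconnected components) of $G$ and the cut-vertices of $G$, a block being adjacent to a cut-vertex iff the block contains it. ''Every cut-vertex $c$ is safe in its descendant blocks'' means: $c$ is safe, in the sense below, in each block of $G$ that is a child of $c$ in the rooted tree $T$. An $\textsc{And}(1)$-realization of a graph $H=(V,E)$ is a family $\{(B_v,p_v):v\in V\}$ of closed real intervals $B_v$ and points $p_v\in B_v$ such that for distinct $u,v$: $uv\in E$ iff $p_v\in B_u$ and $p_u\in B_v$; it is a $c$-$\textsc{And}(1)$-realization if each $p_v$ is the center of $B_v$. $\textsc{And}(1)$ (resp. $c$-$\textsc{And}(1)$) is the class of graphs admitting such a realization. For $H$ in the class, a vertex $v$ is safe in $H$ if there is a realization of $H$ of the corresponding type such that for all $w\in V(H)$: $p_v\in B_w$ iff $v=w$ or $vw\in E(H)$. *)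

(* Defs.v *)
From HB Require Import structures.
From mathcomp Require Import all_boot all_order all_algebra.
From mathcomp Require Import reals.

Set Implicit Arguments.
Unset Strict Implicit.
Unset Printing Implicit Defensive.

Import Order.TTheory GRing.Theory Num.Theory.
Local Open Scope ring_scope.

Record sgraph := SGraph {
  svertex :> finType;
  sedge : rel svertex;
  sedge_sym : symmetric sedge;
  sedge_irrefl : irreflexive sedge
}.

Section Induced.
Variables (G : sgraph) (S : {set G}).

Definition induced_edge : rel {x : G | x \in S} :=
  fun x y => sedge (val x) (val y).

Lemma induced_edge_sym : symmetric induced_edge.
Proof. by move=> x y; apply: sedge_sym. Qed.

Lemma induced_edge_irrefl : irreflexive induced_edge.
Proof. by move=> x; apply: sedge_irrefl. Qed.

Definition induced : sgraph := SGraph induced_edge_sym induced_edge_irrefl.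
End Induced.

(* The graph without vertices counts as connected, so that the one-vertex
   graph has no cut-vertex (and is its own unique block). *)
Definition connected_graph (G : sgraph) : bool :=
  [forall x : G, forall y : G, connect (@sedge G) x y].

(* Only meant for connected G. *)
Definition cut_vertex (G : sgraph) (v : G) : bool :=
  ~~ connected_graph (induced [set~ v]).

(* K_1 and K_2 are biconnected, so bridges are blocks. *)
Definition biconnected (G : sgraph) : bool :=
  connected_graph G && [forall v : G, ~~ cut_vertex v].

Definition is_block (G : sgraph) (B : {set G}) : bool :=
  maxset (fun S : {set G} => biconnected (induced S)) B.

Section BlockTree.
Variable G : sgraph.

Definition block := {B : {set G} | is_block B}.
Definition cutv := {v : G | cut_vertex v}.

Definition block_tree_edge : rel (block + cutv)%type :=
  fun x y => match x, y with
             | inl B, inr c | inr c, inl B => val c \in val B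
             | _, _ => false
             end.

Lemma block_tree_edge_sym : symmetric block_tree_edge.
Proof. by move=> [B|c] [B'|c']. Qed.

Lemma block_tree_edge_irrefl : irreflexive block_tree_edge.
Proof. by move=> [B|c]. Qed.

Definition block_tree : sgraph :=
  SGraph block_tree_edge_sym block_tree_edge_irrefl.
End BlockTree.

(* In the tree T rooted at r, y is a child of x: x is the vertex preceding y
   on the (unique) simple path from r to y. *)
Definition child (T : sgraph) (r x y : T) : Prop :=
  exists p : seq T, [/\ path (@sedge T) r (rcons p y),
                        uniq (r :: rcons p y) &
                        last r p = x].

Section Realizations.
Variable R : realType.

(* Bounded closed intervals [lo v, hi v], possibly reduced to a point, each with
   a distinguished point. *)
Record pointed_intervals (V : Type) := PointedIntervals {
  lo : V -> R;
  hi : V -> R;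
  pt : V -> R;
  pt_itv : forall v, pt v \in `[lo v, hi v]
}.

Definition box (V : Type) (f : pointed_intervals V) (v : V) : interval R :=
  `[lo f v, hi f v].

Definition realization_type := forall H : sgraph, pointed_intervals H -> Prop.

Definition and1_realization : realization_type := fun H f =>
  forall u v : H, u != v ->
    (sedge u v <-> pt f v \in box f u /\ pt f u \in box f v).

Definition c_and1_realization : realization_type := fun H f =>
  and1_realization f /\ forall v : H, pt f v = (lo f v + hi f v) / 2.

Definition realizable (P : realization_type) (H : sgraph) : Prop :=
  exists f : pointed_intervals H, P H f.

Definition and1 : sgraph -> Prop := realizable and1_realization.
Definition c_and1 : sgraph -> Prop := realizable c_and1_realization.

Definition safe (P : realization_type) (H : sgraph) (v : H) : Prop :=
  exists2 f : pointed_intervals H, P H f &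
    forall w : H, pt f v \in box f w <-> v = w \/ sedge v w.

Definition safe_in_child_blocks (P : realization_type) (G : sgraph)
    (r : block_tree G) : Prop :=
  forall (c : cutv G) (B : block G),
    child r (inr c : block_tree G) (inl B : block_tree G) ->
    forall u : induced (val B), val u = val c -> safe P u.
End Realizations.

(* Main.v *)
(** Grow a vertex set [S], starting from the root of the block tree, by adding one
    child block [B] at a time, glued at its parent cut-vertex [c].  First enlarge
    all intervals of the realization of [S] slightly and shift [(B_c, p_c)] so that
    [p_c] is distinct from all other points; both steps preserve all incidences.
    Then insert a copy of a realization of [B] in which [c] is safe, with [p_c] placed
    at the point of [c] and shrunk so much that it lies inside the enlarged
    [B_c] and meets no other point of [S].  The vertices of [B] now all have their
    points in [B_c], so adjacency to [c] depends only on which of their intervals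
    contain [p_c], and safety says that these are the correct ones.
    The growing set stays gated, since a path outside a block joining two of its
    vertices could be added to the block; hence [B] meets [S] only in [c] and no
    edge joins the rest of [S] to the rest of [B]. *)

Require Import Defs.
From HB Require Import structures.
From mathcomp Require Import all_boot all_order all_algebra.
From mathcomp Require Import reals.
From mathcomp Require Import lra.

Set Implicit Arguments.
Unset Strict Implicit.
Unset Printing Implicit Defensive.

Import Order.TTheory GRing.Theory Num.Theory.

(** * Connectivity and biconnectivity of vertex sets; ears *)

Section Graph.
Variable G : sgraph.
Implicit Types (A B S : {set G}) (x y z u v w : G).

(** Restricting the edge relation keeps all walks on the vertex type of [G], so that different sets
    can be compared without nested subtypes. *)
Definition restr A : rel G := fun x y => [&& x \in A, y \in A & sedge x y].
Arguments restr A x y /.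

Definition connected_in A := forall x y, x \in A -> y \in A -> connect (restr A) x y.

Definition biconnected_in A :=
  connected_in A /\ forall v, v \in A -> connected_in (A :\ v).

(* A walk that leaves S can only come back at the vertex where it left. *)
Definition gated S := forall x y a b,
  x \in S -> y \in S -> a \notin S -> connect (restr (~: S)) a b ->
  sedge x a -> sedge b y -> x = y.

Lemma restr_sym A : symmetric (restr A).
Proof. by move=> x y /=; rewrite andbCA sedge_sym. Qed.

Lemma connect_restrC A x y : connect (restr A) x y = connect (restr A) y x.
Proof. exact/sym_connect_sym/restr_sym. Qed.

Lemma connect_restrW A B x y :
  A \subset B -> connect (restr A) x y -> connect (restr B) x y.
Proof.
move=> sAB; apply: connect_sub => a b /= /and3P[aA bA ab].
by apply: connect1; rewrite /= ab !(subsetP sAB).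
Qed.

Lemma connect_restr_in A x y : x \in A -> connect (restr A) x y -> y \in A.
Proof.
move=> xA /connectP[p]; elim/last_ind: p => [_ ->//|p z _].
by rewrite rcons_path last_rcons => /andP[_ /and3P[_ zA _]] ->.
Qed.

(** The embedding is arbitrary because cut-vertices of [induced A] involve an induced subgraph of an
    induced subgraph, embedded by [val \o val]. *)
Lemma connected_in_embed (H : sgraph) (f : H -> G) A : injective f ->
    (forall h k, sedge h k = sedge (f h) (f k)) ->
    (forall x, x \in A <-> exists h, f h = x) ->
  connected_graph H <-> connected_in A.
Proof.
move=> f_inj f_edge f_im; split=> [cH _ _ /f_im[x <-] /f_im[y <-]|cA].
  have /connectP[p pP ->] := forallP (forallP cH x) y.
  elim: p x pP => [|z p IHp] x //= /andP[xz pP].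
  apply: connect_trans (IHp _ pP); apply: connect1.
  by rewrite /= -f_edge xz !(proj2 (f_im _)); [|exists z|exists x].
apply/forallP=> x; apply/forallP=> y.
have fA h : f h \in A by apply/f_im; exists h.
have /connectP[p] := cA _ _ (fA x) (fA y).
elim: p x => [|z p IHp] x /=; first by move=> _ /f_inj ->.
case/andP=> /and3P[_ /f_im[z' <-] xz] pP yE.
by apply: connect_trans (IHp _ pP yE); apply: connect1; rewrite f_edge.
Qed.

Lemma biconnected_inP A : biconnected (induced A) <-> biconnected_in A.
Proof.
have connA : connected_graph (induced A) <-> connected_in A.
  apply: (@connected_in_embed (induced A) val) => // [|x]; first exact: val_inj.
  by split=> [xA|[h <-]]; [exists (exist _ x xA) | exact: (valP h)].
have connD (v : induced A) :
    connected_graph (induced [set~ v]) <-> connected_in (A :\ val v).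
  apply: (@connected_in_embed (induced [set~ v]) (val \o val)) => // [|x].
    exact: inj_comp val_inj val_inj.
  split=> [|[h <-]].
    rewrite !inE => /andP[xv xA].
    pose x' : induced A := exist _ x xA.
    have x'P : x' \in [set~ v] by rewrite !inE -val_eqE.
    by exists (exist _ x' x'P).
  have := valP h; rewrite !inE -val_eqE => hv.
  by rewrite /= hv; exact: (valP (val h)).
split=> [/andP[/connA cA /forallP cv]|[/connA cA cD]].
  split=> // v vA; apply/(connD (exist _ v vA)).
  by have := cv (exist _ v vA); rewrite negbK.
rewrite /biconnected cA; apply/forallP=> v; rewrite negbK.
by apply/connD/cD; exact: (valP v).
Qed.

Lemma cut_vertexN v : ~ connected_in [set~ v] -> cut_vertex v.
Proof.
move=> ncv; apply/negP=> cv; apply: ncv.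
apply: ((@connected_in_embed (induced [set~ v]) val _ val_inj _ _).1 cv) => // x.
by split=> [xP|[h <-]]; [exists (exist _ x xP) | exact: (valP h)].
Qed.

Lemma connected_in1 x : connected_in [set x].
Proof. by move=> _ _ /set1P-> /set1P->. Qed.

Lemma connected_inU A B x y : connected_in A -> connected_in B ->
  x \in A -> y \in B -> sedge x y -> connected_in (A :|: B).
Proof.
move=> cA cB xA yB xy.
have xy' : connect (restr (A :|: B)) x y.
  by apply: connect1; rewrite /= !inE xA yB xy orbT.
have toA a b : a \in A -> b \in A -> connect (restr (A :|: B)) a b.
  by move=> aA bA; apply: connect_restrW (subsetUl _ _) (cA _ _ aA bA).
have toB a b : a \in B -> b \in B -> connect (restr (A :|: B)) a b.
  by move=> aA bA; apply: connect_restrW (subsetUr _ _) (cB _ _ aA bA).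
have cross a b : a \in A -> b \in B -> connect (restr (A :|: B)) a b.
  by move=> aA bB; apply: connect_trans (toA a x aA xA) (connect_trans xy' (toB _ _ yB bB)).
move=> a b /setUP[aA|aB] /setUP[bA|bB]; first [exact: toA | exact: toB | exact: cross | idtac].
by rewrite connect_restrC; apply: cross.
Qed.

Lemma connected_in_path x p : path (@sedge G) x p -> connected_in [set z in x :: p].
Proof.
elim: p x => [|y p IHp] x /=; first by rewrite set_cons set_nil setU0 => _; apply: connected_in1.
case/andP=> xy pP; rewrite set_cons.
apply: connected_inU (IHp _ pP) (set11 x) _ xy; first exact: connected_in1.
by rewrite !inE eqxx.
Qed.

Lemma biconnected_in1 x : biconnected_in [set x].
Proof.
split=> [|v /set1P->]; first exact: connected_in1.
by rewrite setDv => a b; rewrite inE.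
Qed.

Lemma biconnected_in_edge x y : sedge x y -> biconnected_in [set x; y].
Proof.
move=> xy; split=> [|v].
  by apply: connected_inU xy; rewrite ?set11 //; apply: connected_in1.
move=> vxy a b; rewrite !inE => /andP[av aE] /andP[bv bE]; suff -> : a = b by apply: connect0.
by move: vxy av aE bv bE; rewrite !inE =>
  /orP[]/eqP-> /negbTE-> /= => [/eqP->|/orP[]// /eqP->] /negbTE-> /=; rewrite ?orbF => /eqP.
Qed.

(** Shorten the walk to a simple path and add it to [B] as an ear. After deletion of a vertex of
    [B], the ear still hangs on [x] or on [y], since these differ. Deletion of a vertex of the ear
    leaves an initial piece attached at [x] and a final piece attached at [y]. *)
Lemma biconnected_in_ear B x y a b : biconnected_in B -> x \in B -> y \in B ->
  x != y -> a \notin B -> connect (restr (~: B)) a b -> sedge x a -> sedge b y ->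
  exists2 X : {set G}, B :|: [set a] \subset X & biconnected_in X.
Proof.
move=> [cB cBv] xB yB xy aB /connectP[p0 p0P bE] xa; rewrite {b}bE.
case/shortenP: p0P => p pP p_uniq _ {p0} lasty.
have pG : path (@sedge G) a p by apply: sub_path pP => u v /and3P[].
have pB : {in a :: p, forall z, z \notin B}.
  move=> z zp; have: z \in ~: B; last by rewrite inE.
  have /(allP) : all [in ~: B] (a :: p).
    rewrite /= inE aB /=.
    elim: p a {xa aB p_uniq lasty pG zp} pP => //= c p IHp a /andP[/and3P[_ cB' _]] /IHp ->.
    by rewrite cB'.
  exact.
exists (B :|: [set z in a :: p]).
  by apply/setUS/subsetP=> z /set1P->; rewrite !inE eqxx.
split.
  by apply: connected_inU cB (connected_in_path pG) xB _ xa; rewrite !inE eqxx.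
move=> w; rewrite inE => /orP[wB|].
  have -> : (B :|: [set z in a :: p]) :\ w = (B :\ w) :|: [set z in a :: p].
    apply/setP=> z; rewrite [in LHS]inE !in_setU in_set1 in_setD1.
    by case: eqVneq => //= ->; rewrite !inE; apply/esym/negbTE/negP => /pB; rewrite wB.
  have [xw|xw] := eqVneq x w.
    apply: connected_inU (cBv w wB) (connected_in_path pG) (_ : y \in _) _ _.
    - by rewrite !inE -xw eq_sym xy.
    - by rewrite inE; apply: (mem_last a p).
    - by rewrite sedge_sym.
  apply: connected_inU (cBv w wB) (connected_in_path pG) (_ : x \in _) _ xa.
  - by rewrite !inE xw.
  - by rewrite !inE eqxx.
rewrite inE => wp; have wB := pB _ wp.
have [p1 [p2 pE]] : exists p1 p2, a :: p = p1 ++ w :: p2.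
  by case/splitPr: wp => p1 p2; exists p1, p2.
have p_uniq' : uniq (p1 ++ w :: p2) by rewrite -pE.
have -> : (B :|: [set z in a :: p]) :\ w = (B :|: [set z in p1]) :|: [set z in p2].
  apply/setP=> z; rewrite pE !inE mem_cat inE.
  have [->|] /= := eqVneq z w; last by rewrite orbA.
  move: p_uniq'; rewrite cat_uniq /= negb_or (negbTE wB) => /and3P[_ /andP[]].
  by move=> /negbTE-> _ /andP[/negbTE->].
have cB1 : connected_in (B :|: [set z in p1]).
  case: p1 pE {p_uniq'} => [|a' p1] pE; first by rewrite set_nil setU0.
  case: pE pG => <- -> pG.
  apply: connected_inU cB _ xB _ xa; last by rewrite !inE eqxx.
  by apply: connected_in_path; move: pG; rewrite cat_path => /andP[].
case: p2 {p_uniq'} pE => [|c p2] pE; first by rewrite set_nil setU0.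
have lastE : last a p = last c p2.
  by rewrite -[last a p]/(last a (a :: p)) pE last_cat.
have pc : path (@sedge G) c p2.
  case: p1 pE {cB1} => [|a' p1] [_ pE]; move: pG; rewrite pE /= ?cat_path /=.
    by case/andP.
  by case/and4P.
rewrite lastE sedge_sym in lasty.
apply: connected_inU cB1 (connected_in_path pc) (_ : y \in _) _ lasty.
  by rewrite inE yB.
by rewrite inE; apply: mem_last.
Qed.

Lemma is_blockP B : is_block B ->
  biconnected_in B /\ forall X, biconnected_in X -> B \subset X -> X = B.
Proof.
move/maxsetP=> [/biconnected_inP bB maxB]; split=> // X /biconnected_inP bX.
exact: maxB.
Qed.

(** A walk returning at a different vertex would yield an ear, against the maximality of the
    block. *)
Lemma block_gated B : is_block B -> gated B.
Proof.
move=> /is_blockP[bB maxB] x y a b xB yB aB ab xa bv.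
apply/eqP/negPn/negP=> xy.
have [X sBX bX] := biconnected_in_ear bB xB yB xy aB ab xa bv.
have /subUsetP[sB /subsetP saX] := sBX.
by move: aB; rewrite -(maxB X bX sB) saX ?set11.
Qed.

Lemma block_exists A : biconnected_in A -> exists2 B : {set G}, is_block B & A \subset B.
Proof.
move=> /biconnected_inP /(maxset_exists (P := fun S => biconnected (induced S))).
by case=> B; exists B.
Qed.

Lemma edge_leaving S x : connected_graph G -> x \in S -> S != setT ->
  exists u v, [/\ u \in S, v \notin S & sedge u v].
Proof.
move=> cG xS; rewrite -subTset => /subsetPn[y _ yS].
have /connectP[p] := forallP (forallP cG x) y.
elim: p x xS => [|z p IHp] x xS /=; first by move=> _ yx; rewrite yx xS in yS.
case/andP=> xz pP yE; have [zS|zS] := boolP (z \in S); first exact: IHp zS pP yE.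
by exists x, z.
Qed.

Lemma first_entry A S v x : v \in A -> v \notin S -> x \in S -> connect (restr A) v x ->
  exists b y, [/\ connect (restr (A :\: S)) v b, y \in A, y \in S & sedge b y].
Proof.
move=> vA vS xS /connectP[p]; elim: p v vA vS => [|z p IHp] v vA vS /=.
  by move=> _ xv; rewrite -xv xS in vS.
case/andP=> /and3P[_ zA vz] pP xE.
have [zS|zS] := boolP (z \in S); first by exists v, z.
have [b [y [zb yA yS bv]]] := IHp z zA zS pP xE.
exists b, y; split=> //; apply: connect_trans zb; apply: connect1.
by rewrite /= !inE vA vS zA zS.
Qed.

(** * Attaching a block to a gated set along an edge that leaves it *)

Section Attach.
Variables (S B : {set G}) (u v : G).
Hypotheses (gS : gated S) (Bblock : is_block B).
Hypotheses (uS : u \in S) (vS : v \notin S) (uv : sedge u v).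
Hypotheses (uB : u \in B) (vB : v \in B).

Let vu : v != u.
Proof. by apply: contraNneq vS => ->. Qed.

(** As [B :\ u] is connected, a second common vertex could be reached from [v] avoiding [u]. With
    the edge [uv] this gives a walk that leaves [S] at [u] and comes back elsewhere. *)
Lemma attach_cap x : x \in S -> x \in B -> x = u.
Proof.
move=> xS xB; apply/eqP/negPn/negP=> xu.
have [[_ /(_ u uB) cBu] _] := is_blockP Bblock.
have := cBu v x; rewrite !inE vu xu vB xB => /(_ isT isT).
have vBu : v \in B :\ u by rewrite !inE vu.
case/(first_entry vBu vS xS) => b [y [vb yB yS bv]].
have vb' : connect (restr (~: S)) v b.
  by apply: connect_restrW vb; apply/subsetP=> z; rewrite !inE => /andP[].
have yu := gS uS yS vS vb' uv bv.
by rewrite -yu !inE eqxx in yB.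
Qed.

(** All of [B :\ u] lies in the component of [v] outside [S], so each of its vertices can take over
    the role of [v] when gatedness is applied. *)
Lemma attach_outside x : x \in B -> x != u ->
  x \notin S /\ connect (restr (~: S)) v x.
Proof.
move=> xB xu; have [[_ /(_ u uB) cBu] _] := is_blockP Bblock.
split; first by apply: contraNN xu => xS; rewrite (attach_cap xS xB).
apply: (@connect_restrW (B :\ u)); last by apply: cBu; rewrite !inE ?vu ?xu.
apply/subsetP=> z; rewrite !inE => /andP[zu zB].
by apply: contraNN zu => zS; rewrite (attach_cap zS zB).
Qed.

Lemma attach_edge x y : x \in S -> x != u -> y \in B -> y != u -> ~~ sedge x y.
Proof.
move=> xS xu yB yu; have [yS vy] := attach_outside yB yu.
apply: contraNN xu => xy; apply/eqP/esym.
by apply: (gS uS xS vS vy uv); rewrite sedge_sym.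
Qed.

Lemma attach_gated : gated (S :|: B).
Proof.
move=> x y a b xSB ySB; rewrite inE negb_or => /andP[aS aB] ab xa bv.
have abS : connect (restr (~: S)) a b.
  by apply: connect_restrW ab; rewrite setCS subsetUl.
have abB : connect (restr (~: B)) a b.
  by apply: connect_restrW ab; rewrite setCS subsetUr.
have bS : b \in ~: S by apply: connect_restr_in abS; rewrite inE.
(* If one end of the walk is in [S] and the other in [B] outside [S], prolong the walk inside
   [B :\ u] to [v]: gatedness of [S] forces the end in [S] to be [u]. Both ends are then in [B],
   which is gated. *)
have mixed x' y' a' b' : x' \in S -> y' \in B -> y' \notin S ->
    a' \notin S -> connect (restr (~: S)) a' b' -> sedge x' a' -> sedge b' y' -> x' \in B.
  move=> x'S y'B y'S a'S a'b' x'a' b'y'.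
  have y'u : y' != u by apply: contraNneq y'S => ->.
  have [_ vy'] := attach_outside y'B y'u.
  have b'S : b' \in ~: S by apply: connect_restr_in a'b'; rewrite inE.
  suff -> : x' = u by [].
  apply/esym/(gS uS x'S vS (b := a')) => //; last by rewrite sedge_sym.
  apply: connect_trans vy' _; rewrite connect_restrC.
  apply: connect_trans a'b' _; apply: connect1.
  by rewrite /= b'S b'y' inE y'S.
have [xS|xS] := boolP (x \in S); have [yS|yS] := boolP (y \in S).
- exact: (gS xS yS aS abS).
- have yB : y \in B by case/setUP: ySB => // yS'; rewrite yS' in yS.
  apply: (block_gated Bblock _ yB aB abB xa bv).
  exact: mixed xS yB yS aS abS xa bv.
- have xB : x \in B by case/setUP: xSB => // xS'; rewrite xS' in xS.
  apply: (block_gated Bblock xB _ aB abB xa bv).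
  rewrite connect_restrC in abS.
  apply: (mixed y x b a) => //; rewrite 1?sedge_sym //.
  by rewrite inE in bS.
- have yB : y \in B by case/setUP: ySB => // yS'; rewrite yS' in yS.
  have xB : x \in B by case/setUP: xSB => // xS'; rewrite xS' in xS.
  exact: (block_gated Bblock xB yB aB abB).
Qed.

(** A walk from [v] to [x] avoiding [u] would reenter [S] at a vertex other than [u]. *)
Lemma attach_cut_vertex x : x \in S -> x != u -> cut_vertex u.
Proof.
move=> xS xu; apply: cut_vertexN => cu.
have vA : v \in [set~ u] by rewrite !inE.
have xA : x \in [set~ u] by rewrite !inE.
have [b [y [vb yA yS bv]]] := first_entry vA vS xS (cu v x vA xA).
have vb' : connect (restr (~: S)) v b.
  by apply: connect_restrW vb; apply/subsetP=> z; rewrite !inE => /andP[].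
by rewrite (gS uS yS vS vb' uv bv) !inE eqxx in yA.
Qed.

End Attach.

End Graph.

(** * Perturbing and gluing interval realizations *)

Section Intervals.
Local Open Scope ring_scope.
Variable R : realType.

Lemma finite_pos_lb (I : finType) (F : I -> R) :
  (forall i, 0 < F i) -> exists2 d, 0 < d & forall i, d < F i.
Proof.
move=> F_gt0; suff [d d_gt0 dF] : exists2 d, 0 < d & {in enum I, forall i, d < F i}.
  by exists d => // i; apply: dF; rewrite mem_enum.
elim: (enum I) => [|i s [d d_gt0 dF]]; first by exists 1.
exists (Num.min d (F i / 2)).
  by rewrite lt_min d_gt0; have := F_gt0 i; lra.
move=> j; rewrite inE gt_min => /predU1P[->|/dF ->//].
by apply/orP; right; have := F_gt0 i; lra.
Qed.

(** The factor 2 leaves room to enlarge intervals by [d] and to shift by [d / 2]. Several vertices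
    may share the point of [c], hence the equality case. *)
Lemma box_margin (V : finType) (f : pointed_intervals R V) (c : V) :
  exists2 d, 0 < d &
    (forall u v, pt f v \notin box f u -> pt f v < lo f u - 2 * d \/ hi f u + 2 * d < pt f v) /\
    (forall u, pt f u = pt f c \/ pt f u < pt f c - 2 * d \/ pt f c + 2 * d < pt f u).
Proof.
(* [F] is the distance from a point to an interval missing it, and [F'] the distance to the point of
   [c]; the value 1 stands where there is no constraint. *)
pose F (uv : V * V) : R :=
  if pt f uv.2 < lo f uv.1 then lo f uv.1 - pt f uv.2
  else if hi f uv.1 < pt f uv.2 then pt f uv.2 - hi f uv.1 else 1.
pose F' (u : V) : R := if pt f u == pt f c then 1 else `|pt f u - pt f c|.
have [d d_gt0 dF] : exists2 d, 0 < d & forall uv, d < F uv.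
  apply: finite_pos_lb => uv; rewrite /F.
  by case: ifP => ?; [lra | case: ifP => ?; lra].
have [d' d'_gt0 dF'] : exists2 d, 0 < d & forall u, d < F' u.
  apply: finite_pos_lb => u; rewrite /F'.
  by case: eqVneq => ?; rewrite ?ltr01 // normr_gt0 subr_eq0.
have [e_le e_le'] : Num.min d d' <= d /\ Num.min d d' <= d'.
  by rewrite !ge_min !lexx orbT.
have e_gt0 : 0 < Num.min d d' by rewrite lt_min d_gt0.
exists (Num.min d d' / 2); first lra.
split=> [u v|u].
  have := dF (u, v); rewrite /F /box in_itv /= negb_and -!ltNge.
  case: (ltP (pt f v)) => [? ? _|_ /=]; first by left; lra.
  by case: ifP => [? ? _|//]; right; lra.
have := dF' u; rewrite /F'; case: eqVneq => [-> _|_]; first by left.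
by rewrite ltr_normr => /orP[]?; right; [right|left]; lra.
Qed.


(** Intervals are assigned to all vertices of [G], so that every stage has the same type; adjacency
    matters on [S] only. The flag [centered] treats both classes at once. *)
Definition realizes_on (centered : bool) (G : sgraph) (S : {set G})
    (f : pointed_intervals R G) :=
  {in S &, forall u v, u != v ->
     sedge u v = (pt f v \in box f u) && (pt f u \in box f v)} /\
  (centered -> forall v, pt f v = (lo f v + hi f v) / 2).

(** Symmetric enlargement, translation and scaling all preserve midpoints, so the same construction
    serves the centered case. *)
Lemma realizes_on_glue (centered : bool) (G : sgraph) (S B : {set G}) (c : G)
    (f g : pointed_intervals R G) :
    realizes_on centered S f -> realizes_on centered B g ->
    c \in S -> c \in B ->
    {in S & B, forall x y, x != c -> y != c -> ~~ sedge x y} ->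
    {in B, forall w, (pt g c \in box g w) = (c == w) || sedge c w} ->
  exists h, realizes_on centered (S :|: B) h.
Proof.
move=> [fS f_ctr] [gB g_ctr] cS cB noSB safe_c.
have [d d_gt0 [d_box d_pt]] := box_margin f c.
(* [e] is the scaling factor of the copy of [g]; the summand 1 keeps the denominator positive. *)
have [e e_gt0 e_lt] : exists2 e, 0 < e &
    forall v, e < d / 4 / (1 + `|lo g v - pt g c| + `|hi g v - pt g c|).
  apply: finite_pos_lb.
  by move=> v; rewrite divr_gt0 // ?divr_gt0 // -addrA ltr_wpDr // addr_ge0.
have e_small v : `|e * (lo g v - pt g c)| <= d / 4 /\ `|e * (hi g v - pt g c)| <= d / 4.
  have := e_lt v; rewrite ltr_pdivlMr; last by rewrite -addrA ltr_wpDr // addr_ge0.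
  rewrite !normrM (gtr0_norm e_gt0).
  have := mulr_ge0 (ltW e_gt0) (normr_ge0 (lo g v - pt g c)).
  have := mulr_ge0 (ltW e_gt0) (normr_ge0 (hi g v - pt g c)).
  move: `|lo g v - pt g c| `|hi g v - pt g c| => a b; nra.
(* [c] is shifted by [d / 2], its new point [a] being at distance at least
   [d / 2] from all other points of [f]; the copy of [g] lives within
   [d / 4] of [a]. *)
pose D := B :\ c; pose a := pt f c + d / 2.
pose t v : R := if v == c then d / 2 else 0.
pose h_lo v := if v \in D then a + e * (lo g v - pt g c) else lo f v - d + t v.
pose h_hi v := if v \in D then a + e * (hi g v - pt g c) else hi f v + d + t v.
pose h_pt v := if v \in D then a + e * (pt g v - pt g c) else pt f v + t v.
have f_itv v : lo f v <= pt f v <= hi f v by have := pt_itv f v; rewrite in_itv.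
have g_itv v : lo g v <= pt g v <= hi g v by have := pt_itv g v; rewrite in_itv.
have h_itv v : h_pt v \in `[h_lo v, h_hi v].
  rewrite in_itv /= /h_pt /h_lo /h_hi; case: ifP => _; last by have := f_itv v; lra.
  by rewrite !lerD2l !ler_pM2l // !lerD2r.
pose h := PointedIntervals h_itv.
have hE u v : (pt h v \in box h u) = (h_lo u <= h_pt v <= h_hi u) by rewrite in_itv.
have tP v : 0 <= t v <= d / 2 by rewrite /t; case: ifP; lra.
have hS u v : u \notin D -> v \notin D -> (pt h v \in box h u) = (pt f v \in box f u).
  move=> uD vD; rewrite hE /h_lo /h_hi /h_pt (negbTE uD) (negbTE vD).
  have := tP u; have := tP v => /andP[v0 v1] /andP[u0 u1].
  have [|/d_box[]] := boolP (pt f v \in box f u); rewrite ?in_itv /=.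
  - by case/andP=> ? ?; apply/andP; split; lra.
  - by move=> ?; apply/negbTE; rewrite negb_and -!ltNge; apply/orP; left; lra.
  - by move=> ?; apply/negbTE; rewrite negb_and -!ltNge; apply/orP; right; lra.
have hB u v : u \in D -> v \in D -> (pt h v \in box h u) = (pt g v \in box g u).
  move=> uD vD; rewrite hE /h_lo /h_hi /h_pt uD vD.
  by rewrite !lerD2l !ler_pM2l // !lerD2r in_itv.
have cD : c \notin D by rewrite !inE eqxx.
have tc : t c = d / 2 by rewrite /t eqxx.
(* The new interval of [c] extends at least [d] to both sides of its point [a], and the copy of [g]
   stays within [d / 4] of [a]. *)
have hcB v : v \in D -> pt h v \in box h c.
  move=> vD; rewrite hE /h_lo /h_hi /h_pt vD (negbTE cD) tc /a.
  have := e_small v; rewrite !ler_norml => -[/andP[l0 l1] /andP[h0 h1]].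
  have := f_itv c => /andP[? ?].
  have [lp ph] : e * (lo g v - pt g c) <= e * (pt g v - pt g c) /\
      e * (pt g v - pt g c) <= e * (hi g v - pt g c).
    by rewrite !ler_pM2l // !lerD2r; have /andP[] := g_itv v.
  by apply/andP; split; lra.
(* The scaling sends the point of [c] in [g] to [a], so the claim reduces to safety of [c]. *)
have hBc v : v \in D -> (pt h c \in box h v) = sedge c v.
  move=> vD; have := vD; rewrite inE in_set1 => /andP[vc vB].
  rewrite hE /h_lo /h_hi /h_pt vD (negbTE cD) tc -/a.
  rewrite -{2 3}(addr0 a) !lerD2l pmulr_rle0 // pmulr_rge0 // subr_ge0 subr_le0.
  by have := safe_c v vB; rewrite in_itv /= eq_sym (negbTE vc).
(* The shift of [c] matters here: a point that coincided with that of [c] is now [d / 2] away from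
   [a], out of reach of the copy. *)
have hSB u v : u \notin D -> u != c -> v \in D -> pt h u \notin box h v.
  move=> uD uc vD; rewrite hE /h_lo /h_hi /h_pt vD (negbTE uD) /t (negbTE uc) /a.
  have := e_small v; rewrite !ler_norml => -[/andP[l0 l1] /andP[h0 h1]].
  by rewrite negb_and -!ltNge; apply/orP; have [|[]] := d_pt u => ?; [left|left|right]; lra.
have SB_D v : v \in S :|: B -> (v \in S /\ v \notin D) \/ (v \in D /\ v \in B /\ v != c).
  have [->|vc] := eqVneq v c; first by left.
  rewrite !inE vc /=; case: (boolP (v \in B)) => vB; first by right.
  by rewrite orbF; left.
exists h; split=> [u v uSB vSB uv|ctr v]; last first.
  rewrite /= /h_pt /h_lo /h_hi; case: ifP => _; last by rewrite (f_ctr ctr v); lra.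
  by rewrite (g_ctr ctr v); lra.
have mixed u' v' : u' \in S -> u' \notin D -> v' \in D -> v' \in B -> v' != c ->
    sedge u' v' = (pt h v' \in box h u') && (pt h u' \in box h v').
  move=> uS uD vD vB vc; have [->|uc] := eqVneq u' c; first by rewrite hcB // hBc.
  by rewrite (negbTE (hSB _ _ uD uc vD)) andbF; apply/negbTE/noSB.
case: (SB_D u uSB) (SB_D v vSB) => [[uS uD]|[uD [uB uc]]] [[vS vD]|[vD [vB vc]]].
- by rewrite !hS // fS.
- exact: mixed.
- by rewrite sedge_sym andbC; apply: mixed.
- by rewrite !hB // gB.
Qed.

Lemma realizes_on_induced (centered : bool) (G : sgraph) (S : {set G})
    (f : pointed_intervals R (induced S)) :
    and1_realization f -> (centered -> forall v, pt f v = (lo f v + hi f v) / 2) ->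
  exists2 g, realizes_on centered S g &
    forall u w : induced S, (pt g (val u) \in box g (val w)) = (pt f u \in box f w).
Proof.
move=> fS f_ctr.
(* Vertices outside [S] get the interval reduced to 0, which is centered. *)
pose ext (F : induced S -> R) v := if insub v is Some x then F x else 0.
have extE F (u : induced S) : ext F (val u) = F u by rewrite /ext valK.
have g_itv v : ext (pt f) v \in `[ext (lo f) v, ext (hi f) v].
  by rewrite /ext; case: insub => [x|]; [exact: pt_itv | rewrite in_itv /= lexx].
pose g := PointedIntervals g_itv.
have gE (u w : induced S) : (pt g (val u) \in box g (val w)) = (pt f u \in box f w).
  by rewrite /box /= !extE.
exists g => //; split=> [u v uS vS uv|ctr v].
  pose u' : induced S := exist _ u uS; pose v' : induced S := exist _ v vS.
  rewrite -[u]/(val u') -[v]/(val v') !gE.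
  have uv' : u' != v' by [].
  by apply/idP/andP => /(fS u' v' uv').
by rewrite /= /ext; case: insub => [x|]; [exact: f_ctr | rewrite addr0 mul0r].
Qed.

End Intervals.

(** * Growing the realized set from the root of the block tree *)

Section Growth.
Variables (R : realType) (G : sgraph) (centered : bool) (P : realization_type R).
Hypothesis PE : forall (H : sgraph) (f : pointed_intervals R H),
  P f <-> and1_realization f /\ (centered -> forall v, pt f v = (lo f v + hi f v) / 2)%R.
Hypothesis G_connected : connected_graph G.
Hypothesis P_block : forall B : {set G}, is_block B -> realizable P (induced B).
Variable r : block_tree G.
Hypothesis r_safe : safe_in_child_blocks P r.

Definition node_within (S : {set G}) (x : block_tree G) :=
  if x is inl B then val B \subset S else true.

(** The last two clauses make the next block usable: an edge leaves [S] only at a cut-vertex, and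
    that cut-vertex is reached from the root through blocks inside [S], so that a block not inside
    [S] is its child. The walk need not be simple. The first clause allows for the empty graph. *)
Definition admissible (S : {set G}) :=
  [/\ G -> exists x, x \in S,
      gated S,
      exists f, realizes_on (R := R) centered S f,
      forall u v, u \in S -> v \notin S -> sedge u v -> cut_vertex u &
      forall c : cutv G, val c \in S -> exists p,
        [/\ path (@sedge (block_tree G)) r p, last r p = inr c &
            all (node_within S) (r :: p)]].

Lemma admissible_root : exists S, admissible S.
Proof.
case rE: r => [B|c].
  exists (val B); have Bblock := valP B; have [bB maxB] := is_blockP Bblock.
  have B_inh : G -> exists x, x \in val B.
    move=> y; apply/set0Pn/eqP => B0.
    have b1 := biconnected_in1 y.
    by have := maxB _ b1; rewrite B0 sub0set => /(_ isT)/setP/(_ y); rewrite !inE eqxx.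
  split=> //.
  - exact: block_gated.
  - have [f /PE[fB f_ctr]] := P_block Bblock.
    by have [g gB _] := realizes_on_induced fB f_ctr; exists g.
  - move=> u v uB vB uv.
    (* The block is not [[set u]], since the biconnected set [[set u; v]] would be larger. *)
    have [x xB xu] : exists2 x, x \in val B & x != u.
      have := biconnected_in_edge uv; case: (set_0Vmem (val B :\ u)) => [B1|[x]].
        move/maxB => BE; case/negP: vB; rewrite -BE ?inE ?eqxx ?orbT //.
        by rewrite -(setD1K uB) B1 setU0 subsetUl.
      by rewrite !inE => /andP[xu xB] _; exists x.
    exact: (attach_cut_vertex (block_gated Bblock) uB vB uv xB xu).
  - by move=> c cB; exists [:: inr c]; rewrite rE /= cB subxx.
exists [set val c]; split=> [_|x y a b /set1P-> /set1P->//||u v /set1P-> _ _|c' /set1P c'E].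
- by exists (val c); rewrite inE.
- have h0 (v : G) : (0 \in `[0 : R, 0])%R by rewrite in_itv /= lexx.
  exists (PointedIntervals h0); split=> [u v /set1P-> /set1P->|_ v]; first by rewrite eqxx.
  by rewrite /= addr0 mul0r.
- exact: (valP c).
- by exists [::]; rewrite rE /= (val_inj c'E).
Qed.

Lemma admissible_grow S : admissible S -> S != setT ->
  exists2 S' : {set G}, S \proper S' & admissible S'.
Proof.
move=> [S_inh gS [f fS] S_cut S_path] SnT.
have [x xS] : exists x, x \in S.
  by move: (SnT); rewrite -subTset => /subsetPn[y _ _]; apply: S_inh.
have [u [v [uS vS uv]]] := edge_leaving G_connected xS SnT.
have [B Bblock] := block_exists (biconnected_in_edge uv).
rewrite subUset !sub1set => /andP[uB vB].
have cu := S_cut u v uS vS uv.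
pose u' : cutv G := exist _ u cu; pose B' : block G := exist _ B Bblock.
have [p [pP p_last p_in]] := S_path u' uS.
(* On a simple path to [u'] every block lies inside [S], whereas [B] contains [v] outside [S];
   appending [B'] therefore keeps the path simple. *)
have uB_child : child r (inr u' : block_tree G) (inl B' : block_tree G).
  move: (p_last) p_in; case/shortenP: pP => q qP q_uniq q_sub q_last.
  move=> /=/andP[r_in /allP p_in].
  exists q; split=> //; first by rewrite rcons_path qP q_last /= uB.
  rewrite -rcons_cons rcons_uniq q_uniq andbT; apply: contraNN vS => B_in.
  have /subsetP : node_within S (inl B' : block_tree G); last exact.
  by move: B_in; rewrite inE => /predU1P[->|/q_sub/p_in].
have [g0 /PE[g0B g0_ctr] g0_safe] := r_safe uB_child (u := exist _ u uB) erefl.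
have [g gB gE] := realizes_on_induced g0B g0_ctr.
exists (S :|: B).
  rewrite properE subsetUl; apply/subsetPn; exists v => //.
  by rewrite inE vB orbT.
split=> [_||||].
- by exists u; rewrite inE uS.
- exact: (attach_gated gS Bblock uS vS uv uB vB).
- apply: (@realizes_on_glue R centered G S B u f g) => // [y z yS zB yu zu|w wB].
    exact: (attach_edge gS Bblock uS vS uv uB vB).
  have := g0_safe (exist _ w wB); rewrite -gE /= => safe_w.
  apply/idP/orP => [/safe_w[/(congr1 val)/= ->|]|]; [by left; rewrite eqxx | by right|].
  by move=> H; apply/safe_w; case: H => [/eqP uw|]; [left; apply: val_inj | right].
- move=> y z ySB zSB yz.
  have gSB := attach_gated gS Bblock uS vS uv uB vB.
  (* To see that [y] is a cut-vertex, a second vertex of [S :|: B] is required: [v] if [y] is [u],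
     and [u] otherwise. *)
  have [uy|uy] := eqVneq u y.
    apply: (attach_cut_vertex gSB ySB zSB yz (x := v)); first by rewrite inE vB orbT.
    by apply: contraNneq vS => ->; rewrite -uy.
  by apply: (attach_cut_vertex gSB ySB zSB yz (x := u)) => //; rewrite inE uS.
move=> c; have node_mono : subpred (node_within S) (node_within (S :|: B)).
  by case=> //= D /subset_trans; apply; apply: subsetUl.
rewrite inE => /orP[cS|cB].
  have [q [qP q_last q_in]] := S_path c cS.
  by exists q; split=> //; apply: sub_all q_in.
(* A cut-vertex of the new block is reached through [u'] and [B']. *)
exists (p ++ [:: (inl B' : block_tree G); (inr c : block_tree G)]); split.
- by rewrite cat_path pP p_last /= uB cB.
- by rewrite last_cat.
by rewrite -cat_cons all_cat (sub_all node_mono p_in) /= subsetUr.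
Qed.

Lemma admissible_all : admissible setT.
Proof.
have [S] := admissible_root.
elim: {S}_.+1 {-2}S (ltnSn #|~: S|) => // n IHn S Sn S_adm.
have [<-//|SnT] := eqVneq S setT.
have [S' SS' S'_adm] := admissible_grow S_adm SnT.
apply: (IHn S') => //; apply: leq_trans (proper_card _) Sn.
by rewrite properC.
Qed.

Lemma realizable_glue : realizable P G.
Proof.
have [_ _ [f [fG f_ctr]] _ _] := admissible_all.
exists f; apply/PE; split=> // u v uv.
by rewrite (fG u v) ?inE //; split=> /andP.
Qed.

End Growth.

Theorem theorem4 (R : realType) (G : sgraph) (G_connected : connected_graph G) :
  ((forall B : {set G}, is_block B -> and1 R (induced B)) ->
   (exists r : block_tree G, safe_in_child_blocks (@and1_realization R) r) ->
   and1 R G)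
  /\
  ((forall B : {set G}, is_block B -> c_and1 R (induced B)) ->
   (exists r : block_tree G, safe_in_child_blocks (@c_and1_realization R) r) ->
   c_and1 R G).
Proof.
split=> G_blocks [r r_safe].
  apply: (@realizable_glue R G false _ _ _ G_blocks r) => // H f.
  by split=> [|[]].
apply: (@realizable_glue R G true _ _ _ G_blocks r) => // H f.
by split=> [[fH f_ctr]|[fH f_ctr]]; split=> //; apply: f_ctr.
Qed.
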